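(* Let $n\le 8$. There is no full $n$-line configuration $C$ such that the number of occurrences of $C$ in every Steiner triple system of order $v$ equals a constant (as a function of $v$) plus a linear combination, with coefficients that are functions of $v$, of the numbers of occurrences of the full $m$-line configurations with $m\le n$ other than $C$.
   Context: A Steiner triple system of order $v$, STS$(v)$, is a pair $(V,\mathcal{B})$ with $|V|=v$ and $\mathcal{B}$ a set of 3-subsets (lines) of $V$ such that every 2-subset of $V$ lies in exactly one line. A configuration is a set system of 3-element lines in which any two points lie in at most one line (equivalently, isomorphic to a set of lines of some STS together with the union of these lines as point set); an $n$-line configuration has $n$ lines, and it is full if every point lies in at least two of its lines. Configurations are considered up to isomorphism (bijection of point sets mapping lines onto lines). The number of occurrences of a configuration $C$ in an STS $(V,\mathcal{B})$ is the number of subsets $\mathcal{B}'\subseteq\mathcal{B}$ which, together with the union of their lines, form a configuration isomorphic to $C$. *)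

(* Defs.v *)
From HB Require Import structures.
From mathcomp Require Import all_boot all_order all_algebra.

Set Implicit Arguments.
Unset Strict Implicit.
Unset Printing Implicit Defensive.

(* The point set of a set of lines B : {set {set T}} is always the union
   [cover B] of its lines; T may contain further, irrelevant, elements. *)

Definition steiner_triple_system (V : finType) (B : {set {set V}}) : Prop :=
  (forall L : {set V}, L \in B -> #|L| = 3) /\
  (forall e : {set V}, #|e| = 2 -> #|[set L in B | e \subset L]| = 1).

(* The set of lines is required to be nonempty: the empty set of lines would
   be vacuously full, and occurs exactly once in every system. *)
Record configuration := Configuration {
  conf_type : finType;
  lines : {set {set conf_type}};
  lines_neq0 : lines != set0;
  card_line : forall L : {set conf_type}, L \in lines -> #|L| = 3;
  lines_linear : forall e : {set conf_type},
    #|e| = 2 -> #|[set L in lines | e \subset L]| <= 1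
}.

Definition n_line (n : nat) (C : configuration) : Prop := #|lines C| = n.

Definition full (C : configuration) : Prop :=
  forall x : conf_type C,
    x \in cover (lines C) -> 2 <= #|[set L in lines C | x \in L]|.

Definition isomorphic (P Q : finType) (A : {set {set P}}) (B : {set {set Q}})
    : bool :=
  [exists f : {ffun P -> Q},
    [&& dinjectiveb f (mem (cover A)),
        f @: cover A == cover B &
        [set f @: (L : {set P}) | L in A] == B]].

Definition occurrences (C : configuration) (V : finType) (B : {set {set V}})
    : nat :=
  #|[set B' : {set {set V}} | (B' \subset B) && isomorphic (lines C) B']|.

(* Main.v *)
Require Import Defs.
From HB Require Import structures.
From mathcomp Require Import all_boot all_order all_algebra all_fingroup.
From mathcomp Require Import ring.

Set Implicit Arguments.
Unset Strict Implicit.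
Unset Printing Implicit Defensive.

Import Order.TTheory GRing.Theory Num.Theory.
Local Open Scope ring_scope.

(* Attach to each line L = {x, y, z} of C three new points x', y', z' and the Pasch
   configuration {x,y,z}, {x,y',z'}, {x',y,z'}, {x',y',z}.  The resulting partial
   triple system embeds in an STS, in which the Pasch configurations can be
   switched independently to {x',y',z'}, {x',y,z}, {x,y',z}, {x,y,z'}, giving 2^n
   systems of the same order.  In the alternating sum over the switches, a
   configuration contributes only if it has a line from each of the n switched
   regions; with at most n lines it has exactly one from each, and being full
   it cannot use a new point, so it is the original copy of C.  Hence the
   alternating sum is 1 for the number of occurrences of C and 0 for constants
   and for the occurrences of every other full configuration with at most n lines.

   The embedding is built one line at a time.  To make a, b, c collinear, pass
   from V to V x F_3 so that V x {0} is a subsystem containing a, b, c but none of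
   the lines already placed, then replace the system on V x {0} by an isomorphic
   one in which {a, b, c} is a line. *)

(** * Steiner triple systems as binary operations *)

(** The operation of a Steiner quasigroup: for distinct [x] and [y], [s x y] is the third point of
    their line. In this equational form transport and tripling become computations. *)
Definition steiner_op (V : finType) (s : V -> V -> V) : Prop :=
  [/\ idempotent_op s, commutative s & forall x y, s x (s x y) = y].

Definition op_line (V : finType) (s : V -> V -> V) (L : {set V}) : bool :=
  (#|L| == 3%N) && [forall x in L, forall y in L, s x y \in L].

Lemma op_lineP (V : finType) (s : V -> V -> V) (L : {set V}) :
  reflect (#|L| = 3%N /\ {in L &, forall x y, s x y \in L}) (op_line s L).
Proof.
apply: (iffP andP) => [[/eqP cL /forall_inP h]|[cL h]].
  by split=> // x y xL yL; have /forall_inP := h x xL; apply.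
split; first exact/eqP.
by apply/forall_inP => x xL; apply/forall_inP => y yL; apply: h.
Qed.

Lemma set3P (T : finType) (a b c x : T) :
  reflect [\/ x = a, x = b | x = c] (x \in [set a; b; c]).
Proof.
rewrite !inE -orbA.
by apply: (iffP or3P); case=> [/eqP|/eqP|/eqP] H;
  [exact: Or31|exact: Or32|exact: Or33|exact: Or31|exact: Or32|exact: Or33].
Qed.

Lemma steiner_op_neq (V : finType) (s : V -> V -> V) (x y : V) :
  steiner_op s -> x != y -> s x y != x.
Proof.
move=> [si sc sk] xy; apply: contraNneq xy => h.
by rewrite -{1}[y](sk x) h si.
Qed.

Lemma op_line3 (V : finType) (s : V -> V -> V) (x y : V) :
  steiner_op s -> x != y -> op_line s [set x; y; s x y].
Proof.
move=> hs xy; have [si sc sk] := hs.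
have nx := steiner_op_neq hs xy.
have ny : s x y != y by rewrite sc; apply: steiner_op_neq; rewrite // eq_sym.
apply/op_lineP; split.
  by rewrite setUC cardsU1 !inE negb_or nx ny cards2 xy.
have E1 := sk x y; have E2 : s y (s x y) = x by rewrite (sc x) sk.
have E3 : s (s x y) x = y by rewrite sc.
have E4 : s (s x y) y = x by rewrite sc.
by move=> u v /set3P[]-> /set3P[]->; apply/set3P;
  rewrite ?si ?E3 ?E4 ?E1 ?E2 ?(sc y x);
  solve [exact: Or31|exact: Or32|exact: Or33].
Qed.

Lemma op_line_eq (V : finType) (s : V -> V -> V) (L : {set V}) (x y : V) :
  steiner_op s -> op_line s L -> x \in L -> y \in L -> x != y ->
  L = [set x; y; s x y].
Proof.
move=> hs /op_lineP[cL hL] xL yL xy; apply/esym/eqP.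
have /op_lineP[c3 _] := op_line3 hs xy.
rewrite eqEcard cL c3 leqnn andbT.
by apply/subsetP => u /set3P[]-> //; apply: hL.
Qed.

(** * Tripling a system to adjoin a line *)

(** Swapping a point of [A] outside [B] with a point of [B] outside [A] shrinks [A :\: B]; induction
    on its size. *)
Lemma imset_perm_ex (V : finType) (A B : {set V}) :
  #|A| = #|B| -> exists p : {perm V}, p @: A = B.
Proof.
have [m] := ubnP #|A :\: B|; elim: m A => // m IH A /ltnSE leAm cAB.
have [AB|] := eqVneq (A :\: B) set0.
  exists 1%g; apply/eqP.
  rewrite eqEcard card_imset; last exact: perm_inj.
  rewrite cAB leqnn andbT; apply/subsetP => _ /imsetP[x xA ->].
  by rewrite perm1; apply: contraFT (in_set0 x) => xB; rewrite -AB inE xB.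
case/set0Pn=> a aAB; move: (aAB); rewrite inE => /andP[aB aA].
have [BA|] := eqVneq (B :\: A) set0.
  have sBA : B \subset A by rewrite -setD_eq0 BA.
  have /eqP EBA : B == A by rewrite eqEcard sBA cAB leqnn.
  by rewrite EBA aA in aB.
case/set0Pn=> b; rewrite inE => /andP[bA bB].
have nab : a != b by apply: contraNneq aB => ->.
have [||p hp] := IH (tperm a b @: A); last 1 first.
- exists (tperm a b * p)%g; rewrite -hp -imset_comp; apply: eq_imset => x.
  by rewrite /= permM.
- apply: leq_trans leAm; apply: proper_card; apply/properP; split.
    apply/subsetP => _ /setDP[/imsetP[x xA ->]].
    case: tpermP => [_|xb|ax bx xB]; rewrite ?bB ?inE //.
      by rewrite -xb xA in bA.
    by rewrite xB.
  exists a => //; rewrite !inE aB /=; apply/imsetP => -[x xA].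
  by case: tpermP => // [xa ab|xb|]; [rewrite ab eqxx in nab
    | rewrite -xb xA in bA | move=> xa _ ax; case: xa].
by rewrite card_imset //; apply: perm_inj.
Qed.

Lemma F3P (i : 'F_3) : [\/ i = 0, i = 1 | i = -1].
Proof.
by case: i => -[|[|[|]]] // h; [apply: Or31|apply: Or32|apply: Or33];
  apply: val_inj.
Qed.

(** The set [L] has two or three points outside [K]. Three signs 1 sum to 3, which is 0 in ['F_3];
    on two points opposite signs cancel. *)
Lemma sign_relation (V : finType) (K L : {set V}) :
  #|L| = 3%N -> (#|L :&: K| <= 1)%N ->
  exists e : V -> 'F_3, (forall x, e x * e x = 1) /\
    \sum_(x in L) e x * (x \notin K)%:R = 0.
Proof.
move=> cL cLK.
have cD : (#|L :&: K| + #|L :\: K| = 3)%N by rewrite cardsID.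
have sumE (e : V -> 'F_3) :
    \sum_(x in L) e x * (x \notin K)%:R = \sum_(x in L :\: K) e x.
  rewrite (big_setID K) /= big1 ?add0r => [|x]; last first.
    by rewrite inE => /andP[_ ->]; rewrite mulr0.
  by apply: eq_bigr => x; rewrite inE => /andP[-> _]; rewrite mulr1.
have [c0|c1] : #|L :&: K| = 0%N \/ #|L :&: K| = 1%N
  by case: #|_| cLK => [|[|]]; auto.
  exists (fun=> 1); split=> [x|]; first by rewrite mulr1.
  rewrite c0 add0n in cD.
  by rewrite sumE sumr_const cD; apply: val_inj.
have /cards2P[y [z [yz yzE]]] : #|L :\: K| == 2%N by rewrite -(eqn_add2l 1) -{1}c1 cD.
exists (fun x => if x == y then -1 else 1); split=> [x|].
  by case: ifP; rewrite ?mulrNN mulr1.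
by rewrite sumE yzE big_setU1 ?inE //= big_set1 eqxx eq_sym (negbTE yz) addNr.
Qed.

Lemma F3_addxxx (i : 'F_3) : i + i + i = 0.
Proof. by have [] := F3P i => ->; apply: val_inj. Qed.

(* The tripled system consists of the vertical lines [{x} x F_3] and, over each line
   [L], the triples solving [\sum_(x in L) e L x * i_x = 0], with the copy of
   [s] on the subsystem [V x {0}] replaced by [t]. *)
Definition triple_op (V : finType) (s t : V -> V -> V)
    (e : {set V} -> V -> 'F_3) (u v : V * 'F_3) : V * 'F_3 :=
  if (u.2 == 0) && (v.2 == 0) then (t u.1 v.1, 0) else
  if u.1 == v.1 then (u.1, - (u.2 + v.2)) else
  let z := s u.1 v.1 in let L := [set u.1; v.1; z] in
  (z, - (e L z * (e L u.1 * u.2 + e L v.1 * v.2))).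

(** A line with two points on level 0 lies wholly on level 0, because the signs are nonzero; so
    replacing [s] by [t] there leaves all other lines intact. *)
Lemma triple_op_steiner (V : finType) (s t : V -> V -> V)
    (e : {set V} -> V -> 'F_3) :
  steiner_op s -> steiner_op t -> (forall L x, e L x * e L x = 1) ->
  steiner_op (triple_op s t e).
Proof.
move=> hs [ti tc tk] ee; have [si sc sk] := hs.
have en0 L x : e L x != 0.
  by apply/eqP => h; move: (ee L x); rewrite h mulr0 => /eqP; rewrite eq_sym oner_eq0.
split.
- move=> [x i]; rewrite /triple_op /= eqxx andbb; case: eqP => [->|_].
    by rewrite ti.
  by congr (_, _); apply/esym/eqP; rewrite -addr_eq0 addrC F3_addxxx.
- move=> [x i] [y j]; rewrite /triple_op /= andbC tc [j + i]addrC [y == x]eq_sym.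
  case: ifP => // _; case: eqP => [->//|_].
  by rewrite sc [[set y; x]]setUC [e _ y * _ + _]addrC.
move=> [x i] [y j]; rewrite {2}/triple_op /=.
case: ifP => [/andP[/eqP-> /eqP->]|ij].
  by rewrite /triple_op /= ?eqxx tk.
case: (eqVneq x y) ij => [<-|xy] ij; rewrite /triple_op /=.
  rewrite oppr_eq0 eqxx; case: ifP => [/andP[/eqP i0]|_].
    by move: ij; rewrite i0 eqxx add0r /= => ->.
  by congr (_, _); ring.
set z := s x y; set L := [set x; y; z].
have zx : z != x := steiner_op_neq hs xy.
rewrite oppr_eq0 mulf_eq0 (negbTE (en0 _ _)) /=.
case: ifP => [/andP[/eqP i0]|_].
  by move: ij; rewrite i0 mulr0 add0r eqxx mulf_eq0 (negbTE (en0 _ _)) /= => ->.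
rewrite eq_sym (negbTE zx) sk -/z.
have -> : [set x; z; y] = L by rewrite /L -setUA [[set z; y]]setUC setUA.
congr (_, _).
(* The squares of the signs are isolated first, since [ring] does not know that they are 1. *)
transitivity (e L z * e L z * (e L y * e L y) * j
   + (e L z * e L z - 1) * e L y * e L x * i); first by ring.
by rewrite !ee; ring.
Qed.

(** Transport [s] along a permutation carrying one of its lines onto [K]. *)
Lemma op_line_ex (V : finType) (s : V -> V -> V) (K : {set V}) :
  steiner_op s -> #|K| = 3%N -> exists2 t, steiner_op t & op_line t K.
Proof.
move=> hs cK.
have /card_gt1P[x [y [_ _ xy]]] : (1 < #|K|)%N by rewrite cK.
have hL := op_line3 hs xy; have /op_lineP[cL cl] := hL.
have [p hp] : exists p : {perm V}, p @: [set x; y; s x y] = K.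
  by apply: imset_perm_ex; rewrite cL cK.
exists (fun u v => p (s (p^-1 u) (p^-1 v))%g); last first.
  apply/op_lineP; split=> // u v.
  rewrite -hp => /imsetP[u' Lu' ->] /imsetP[v' Lv' ->].
  by rewrite !permK; apply: imset_f; apply: cl.
case: hs => si sc sk; split=> [u|u v|u v].
- by rewrite si permKV.
- by rewrite sc.
- by rewrite permK sk permKV.
Qed.

(** The points of [K] go to level 0 and all others to level 1. Then [K] becomes a line of the copy
    of [t] on level 0, whereas a line of [Q] has at most one point there, and its signs are chosen
    so that its image solves the equation of the tripled system. *)
Lemma adjoin_line (V : finType) (s : V -> V -> V) (Q : {set {set V}})
    (K : {set V}) :
  steiner_op s -> (forall L, L \in Q -> op_line s L) -> #|K| = 3%N ->
  (forall L, L \in Q -> (#|L :&: K| <= 1)%N) ->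
  exists (W : finType) (t : W -> W -> W) (g : V -> W),
    [/\ steiner_op t, injective g, op_line t (g @: K)
      & forall L, L \in Q -> op_line t (g @: L)].
Proof.
move=> hs hQ cK hQK.
have [t ht hK] := op_line_ex hs cK.
have [e he] : exists e : {set V} -> {ffun V -> 'F_3}, forall L,
    (forall x, e L x * e L x = 1) /\
    (L \in Q -> \sum_(x in L) e L x * (x \notin K)%:R = 0).
  apply: (@fin_all_exists _ (fun=> _) (fun L (f : {ffun V -> 'F_3}) =>
    (forall x, f x * f x = 1) /\
    (L \in Q -> \sum_(x in L) f x * (x \notin K)%:R = 0))) => L.
  have [LQ|_] := boolP (L \in Q); last first.
    by exists [ffun=> 1]; split=> // x; rewrite ffunE mulr1.
  have /op_lineP[cL _] := hQ L LQ.
  have [f [ff fs]] := sign_relation cL (hQK L LQ).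
  exists (finfun f); split=> [x|_]; first by rewrite ffunE.
  by rewrite -[RHS]fs; apply: eq_bigr => x _; rewrite ffunE.
pose g x : V * 'F_3 := (x, (x \notin K)%:R).
have g_inj : injective g by move=> x y [].
exists (V * 'F_3)%type, (triple_op s t e), g; split => //.
- by apply: triple_op_steiner => // L x; have [] := he L.
- have /op_lineP[_ clK] := hK.
  apply/op_lineP; rewrite card_imset //; split=> //.
  move=> _ _ /imsetP[x xK ->] /imsetP[y yK ->].
  rewrite /triple_op /g /= xK yK eqxx /=; apply/imsetP.
  by exists (t x y); rewrite ?clK.
move=> L LQ; have hL := hQ _ LQ; have /op_lineP[cL clL] := hL.
have ht' : steiner_op (triple_op s t e).
  by apply: triple_op_steiner => // M x; have [] := he M.
have [ti' _ _] := ht'.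
apply/op_lineP; rewrite card_imset //; split=> //.
move=> _ _ /imsetP[x xL ->] /imsetP[y yL ->].
have [->|xy] := eqVneq x y; first by rewrite ti' imset_f.
have nK : ~~ ((x \in K) && (y \in K)).
  apply/negP => /andP[xK yK].
  have := hQK _ LQ; rewrite leqNgt => /card_gt1P[].
  by exists x, y; rewrite !inE xL xK yL yK.
rewrite /triple_op /=.
have -> : ((x \notin K)%:R == 0 :> 'F_3) && ((y \notin K)%:R == 0 :> 'F_3) = false.
  by move: nK; case: (x \in K); case: (y \in K).
rewrite (negbTE xy) -(op_line_eq hs hL xL yL xy).
set z := s x y; have zL : z \in L by apply: clL.
have zx : z != x := steiner_op_neq hs xy.
have zy : z != y by rewrite /z; case: (hs) => _ -> _; apply: steiner_op_neq; rewrite // eq_sym.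
have [ee /(_ LQ)] := he L.
rewrite {1}(op_line_eq hs hL xL yL xy) -/z setUC big_setU1 ?inE ?negb_or ?zx ?zy //=.
rewrite big_setU1 ?inE //= big_set1 => E.
(* Solving the relation [E] for the coordinate over [z], whose sign squares to 1, gives the level at
   which [g] puts [z]. *)
apply/imsetP; exists z => //; rewrite /g; congr (_, _).
transitivity (e L z * e L z * (z \notin K)%:R); last by rewrite ee mul1r.
by rewrite -[RHS]subr0 -[in RHS](mulr0 (e L z)) -[in RHS]E; ring.
Qed.

(* Treash's theorem. *)
Theorem partial_triple_system_embedding (T : finType) (P : {set {set T}}) :
  (forall L, L \in P -> #|L| = 3%N) ->
  {in P &, forall L M, L != M -> (#|L :&: M| <= 1)%N} ->
  exists (V : finType) (s : V -> V -> V) (f : T -> V),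
    [/\ steiner_op s, injective f & forall L, L \in P -> op_line s (f @: L)].
Proof.
have [m] := ubnP #|P|; elim: m P => // m IH P /ltnSE lePm c3 lin.
have [->|/set0Pn[K KP]] := eqVneq P set0.
  (* Base case: the affine space over ['F_3], where three distinct points are collinear when they
     sum to 0; [T] goes to the standard basis. *)
  exists {ffun T -> 'F_3}, (fun x y => - (x + y)).
  exists (fun a => [ffun b => (a == b)%:R]); split; last by move=> L; rewrite inE.
    split=> [x|x y|x y]; apply/ffunP => a; rewrite !ffunE; last by ring.
      by apply/esym/eqP; rewrite -addr_eq0 addrC F3_addxxx.
    by rewrite addrC.
  move=> a b /ffunP/(_ a)/eqP; rewrite !ffunE eqxx.
  by have [->//|] := eqVneq b a.
have [|||V [s [f [hs fi hP]]]] := IH (P :\ K).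
- by move: lePm; rewrite (cardsD1 K) KP.
- by move=> L /setD1P[_ /c3].
- by move=> L M /setD1P[_ LP] /setD1P[_ MP]; apply: lin.
have [|||W [t [g [ht gi hK hQ]]]] := @adjoin_line V s
  [set f @: (L : {set T}) | L in P :\ K] (f @: K) hs.
- by move=> _ /imsetP[L LP ->]; apply: hP.
- by rewrite card_imset // c3.
- move=> _ /imsetP[L /setD1P[LK LP] ->].
  by rewrite -imsetI ?card_imset //; [apply: lin|move=> x y _ _; apply: fi].
exists W, t, (g \o f); split=> // [|L LP]; first exact: inj_comp.
rewrite imset_comp; have [->//|LK] := eqVneq L K.
by apply: hQ; apply: imset_f; rewrite !inE LK.
Qed.

(** * Parity arguments and Pasch configurations over lines *)

Definition toggle (T : finType) (x : T) (A : {set T}) : {set T} :=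
  if x \in A then A :\ x else x |: A.

Lemma in_toggle (T : finType) (x y : T) (A : {set T}) :
  (y \in toggle x A) = (y == x) (+) (y \in A).
Proof.
rewrite /toggle; case: ifP => xA; rewrite !inE; case: eqVneq => //= ->;
by rewrite xA.
Qed.

Lemma toggleK (T : finType) (x : T) : involutive (toggle x).
Proof. by move=> A; apply/setP => y; rewrite !in_toggle addbA addbb. Qed.

Lemma odd_toggle (T : finType) (x : T) (A : {set T}) :
  odd #|toggle x A| = ~~ odd #|A|.
Proof.
rewrite /toggle; case: ifP => xA; last by rewrite cardsU1 xA.
by rewrite [in RHS](cardsD1 x) xA /= negbK.
Qed.

Lemma eq_set_parity (T : finType) (x : T) (A B : {set T}) :
  {in predC1 x, A =i B} -> odd #|A| = odd #|B| -> A = B.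
Proof.
move=> AB oAB.
have D : A :\ x = B :\ x.
  by apply/setP => y; rewrite !inE; case: eqVneq => //= yx; apply: AB.
have xAB : (x \in A) = (x \in B).
  move: oAB; rewrite (cardsD1 x A) (cardsD1 x B) D !oddD !oddb.
  exact: addIb.
by apply/setP => y; have [->//|yx] := eqVneq y x; apply: AB.
Qed.

Lemma card3_third (T : finType) (L : {set T}) (p q : T) :
  #|L| = 3%N -> p \in L -> q \in L -> p != q ->
  exists r, [/\ r \in L, p != r, q != r
    & forall x, x \in L -> x != r -> x = p \/ x = q].
Proof.
move=> cL pL qL pq.
have /eqP/cards1P[r hr] : #|L :\ p :\ q| = 1%N.
  apply/eqP; rewrite -(eqn_add2l 2) -[2%N]/(1 + 1)%N -addnA.
  have -> : (1 + #|L :\ p :\ q|)%N = #|L :\ p|.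
    by rewrite [RHS](cardsD1 q) !inE eq_sym pq qL.
  by move: (cardsD1 p L); rewrite pL cL => <-.
have /setD1P[rq /setD1P[rp rL]] : r \in L :\ p :\ q by rewrite hr set11.
exists r; split; rewrite // 1?eq_sym // => x xL xr.
have [->|xp] := eqVneq x p; first by left.
have [->|xq] := eqVneq x q; first by right.
have : x \in L :\ p :\ q by rewrite !inE xq xp.
by rewrite hr inE (negbTE xr).
Qed.

Lemma lines_eq (C : configuration) (L M : {set conf_type C}) (x y : conf_type C) :
  L \in lines C -> M \in lines C -> x != y ->
  x \in L -> y \in L -> x \in M -> y \in M -> L = M.
Proof.
move=> LC MC xy xL yL xM yM.
have c2 : #|[set x; y]| = 2 by rewrite cards2 xy.
have := lines_linear c2.
move/card_le1_eqP; apply; rewrite inE ?LC ?MC /=;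
by apply/subsetP => u /set2P[]->.
Qed.

(* Over a line [L], the new points [inr (L, p)] give eight triples
   [pasch_line L A], one for each [A \subset L]; the four with [#|A|] even form a
   Pasch configuration, the four with [#|A|] odd the Pasch configuration
   covering the same pairs. *)
Definition pasch_point (P : finType) (L A : {set P}) (p : P) :
    P + {set P} * P :=
  if p \in A then inr (L, p) else inl p.

Definition pasch_line (P : finType) (L A : {set P}) : {set P + {set P} * P} :=
  pasch_point L A @: L.

Definition pasch_base (P : finType) (u : P + {set P} * P) : P :=
  match u with inl p => p | inr Lp => Lp.2 end.

Lemma pasch_pointK (P : finType) (L A : {set P}) :
  cancel (pasch_point L A) (@pasch_base P).
Proof. by move=> p; rewrite /pasch_point; case: ifP. Qed.

Lemma card_pasch_line (P : finType) (L A : {set P}) : #|pasch_line L A| = #|L|.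
Proof. by rewrite card_imset //; apply: can_inj (@pasch_pointK _ _ _). Qed.

Lemma pasch_lineE (P : finType) (L A : {set P}) (u : P + {set P} * P) :
  (u \in pasch_line L A) =
    (pasch_base u \in L) && (u == pasch_point L A (pasch_base u)).
Proof.
apply/imsetP/andP => [[p pL ->]|[uL /eqP uE]]; last by exists (pasch_base u).
by rewrite pasch_pointK.
Qed.

Lemma inr_pasch_line (P : finType) (L A M : {set P}) (p : P) :
  (inr (M, p) \in pasch_line L A) = [&& p \in L, p \in A & M == L].
Proof.
rewrite pasch_lineE /= /pasch_point; case: ifP => //= _.
by rewrite -[_ == _]/((M, p) == (L, p)) xpair_eqE eqxx andbT.
Qed.

Lemma pasch_line_inj (P : finType) (L M A B : {set P}) :
  A \subset L -> B \subset M -> pasch_line L A = pasch_line M B ->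
  L = M /\ A = B.
Proof.
move=> AL BM E.
have LM : L = M.
  have base K D : @pasch_base P @: pasch_line K D = K.
    rewrite -imset_comp -[RHS]imset_id; apply: eq_imset => p /=.
    by rewrite pasch_pointK.
  by rewrite -(base L A) E base.
split=> //; subst M; apply/setP => p.
have [pL|pL] := boolP (p \in L).
  have := inr_pasch_line L A L p; rewrite E inr_pasch_line pL eqxx !andbT /=.
  by move=> ->.
by rewrite !(contraNF (subsetP _ p) pL).
Qed.

(** Two common points have distinct bases, so linearity gives [L = M]; they fix [A] and [B] at two
    points of [L], and the parity settles the third. *)
Lemma pasch_line_meet (C : configuration) (L M A B : {set conf_type C}) u v :
  L \in lines C -> M \in lines C -> A \subset L -> B \subset M -> u != v ->
  u \in pasch_line L A -> v \in pasch_line L A ->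
  u \in pasch_line M B -> v \in pasch_line M B ->
  L = M /\ (odd #|A| = odd #|B| -> A = B).
Proof.
move=> LC MC AL BM uv.
rewrite !pasch_lineE => /andP[uL /eqP uA] /andP[vL /eqP vA].
move=> /andP[uM /eqP uB] /andP[vM /eqP vB].
have buv : pasch_base u != pasch_base v.
  by apply: contraNneq uv => E; rewrite uA vA E.
have LM := lines_eq LC MC buv uL vL uM vM; subst M; split=> // oAB.
have [r [rL ur vr hr]] := card3_third (card_line LC) uL vL buv.
have same x : pasch_point L A x = pasch_point L B x -> (x \in A) = (x \in B).
  by rewrite /pasch_point; case: ifP; case: ifP.
apply: (@eq_set_parity _ r) => // x; rewrite inE => xr.
have [xL|xL] := boolP (x \in L); last by rewrite !(contraNF (subsetP _ x) xL).
by case: (hr x xL xr) => ->; apply: same; rewrite -?uA -?vA.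
Qed.

(** Toggling the third point of [L] keeps both given points on the line and changes the parity. *)
Lemma pasch_line_switch (P : finType) (L A : {set P}) u v :
  #|L| = 3%N -> A \subset L -> u != v ->
  u \in pasch_line L A -> v \in pasch_line L A ->
  exists A' : {set P}, [/\ A' \subset L, odd #|A'| = ~~ odd #|A|,
    u \in pasch_line L A' & v \in pasch_line L A'].
Proof.
move=> cL AL uv; rewrite !pasch_lineE => /andP[uL /eqP uA] /andP[vL /eqP vA].
have buv : pasch_base u != pasch_base v.
  by apply: contraNneq uv => E; rewrite uA vA E.
have [r [rL ur vr _]] := card3_third cL uL vL buv.
exists (toggle r A); rewrite odd_toggle !pasch_lineE uL vL /=.
split=> //.
- apply/subsetP => x; rewrite in_toggle; case: eqVneq => [->//|_] /=.
  exact: (subsetP AL).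
- by rewrite /pasch_point in_toggle (negbTE ur) /= -/(pasch_point L A _) -uA.
- by rewrite /pasch_point in_toggle (negbTE vr) /= -/(pasch_point L A _) -vA.
Qed.

(** The set [S] records the switched lines: a member of [N] carries the odd Pasch configuration if
    it is in [S], and the even one otherwise. *)
Definition pasch_lines (P : finType) (N S : {set {set P}}) :
    {set {set P + {set P} * P}} :=
  [set M | [exists L in N, exists A : {set P},
    [&& A \subset L, odd #|A| == (L \in S) & M == pasch_line L A]]].

Lemma pasch_linesP (P : finType) (N S : {set {set P}}) M :
  reflect (exists L A : {set P}, [/\ L \in N, A \subset L, odd #|A| = (L \in S)
      & M = pasch_line L A])
    (M \in pasch_lines N S).
Proof.
rewrite inE; apply: (iffP exists_inP) => [[L LN /existsP[A]]|[L [A [LN AL oA ->]]]].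
  by case/and3P=> AL /eqP oA /eqP ->; exists L, A.
by exists L => //; apply/existsP; exists A; rewrite AL oA !eqxx.
Qed.

Lemma pasch_lines_embedding (C : configuration) :
  exists (V : finType) (s : V -> V -> V)
      (f : conf_type C + {set conf_type C} * conf_type C -> V),
    [/\ steiner_op s, injective f
      & forall M, M \in pasch_lines (lines C) set0 -> op_line s (f @: M)].
Proof.
apply: partial_triple_system_embedding.
  move=> _ /pasch_linesP[L [A [LC AL _ ->]]].
  by rewrite card_pasch_line (card_line LC).
move=> _ _ /pasch_linesP[L [A [LC AL oA ->]]] /pasch_linesP[M [B [MC BM oB ->]]].
apply: contraNT; rewrite -ltnNge => /card_gt1P[u [v []]].
rewrite !inE => /andP[uL uM] /andP[vL vM] uv.
have [LM AB] := pasch_line_meet LC MC AL BM uv uL vL uM vM.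
by rewrite LM AB // oA oB !inE.
Qed.

(** * Switched Steiner triple systems *)

(** When the even Pasch lines are lines of [s], the choice [S = set0] gives back the system of
    [s]. *)
Definition op_switch (P V : finType) (s : V -> V -> V)
    (f : P + {set P} * P -> V) (N S : {set {set P}}) : {set {set V}} :=
  [set M | op_line s M] :\: [set f @: (M : {set _}) | M in pasch_lines N set0]
    :|: [set f @: (M : {set _}) | M in pasch_lines N S].

Lemma steiner_triple_systemI (V : finType) (B : {set {set V}}) :
  (forall L, L \in B -> #|L| = 3%N) ->
  (forall x y, x != y -> exists L, [/\ L \in B, x \in L & y \in L]) ->
  (forall L M x y, L \in B -> M \in B -> x != y ->
     x \in L -> y \in L -> x \in M -> y \in M -> L = M) ->
  steiner_triple_system B.
Proof.
move=> c3 ex un; split=> // e /eqP/cards2P[x [y [xy ->]]].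
have [L [LB xL yL]] := ex x y xy.
apply/eqP/cards1P; exists L; apply/setP => M; rewrite !inE subUset !sub1set.
apply/and3P/eqP => [[MB xM yM]|->//].
exact: (un _ _ x y).
Qed.

(** For each [L] the even and odd Pasch configurations cover the same pairs, so exchanging them
    keeps every pair in exactly one line. *)
Lemma op_switch_sts (C : configuration) (V : finType) (s : V -> V -> V) f S :
  steiner_op s -> injective f ->
  (forall M, M \in pasch_lines (lines C) set0 -> op_line s (f @: M)) ->
  steiner_triple_system (op_switch s f (lines C) S).
Proof.
move=> hs fi hM.
have lineE x y L M : op_line s L -> op_line s M -> x != y ->
    x \in L -> y \in L -> x \in M -> y \in M -> L = M.
  move=> hL hL' xy xL yL xM yM.
  by rewrite (op_line_eq hs hL xL yL xy) (op_line_eq hs hL' xM yM xy).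
(* A line of [s] sharing two points with a Pasch line of either parity is itself an even Pasch line,
   hence among those removed. *)
have cross (L A : {set conf_type C}) (M : {set V}) u v : L \in lines C -> A \subset L -> u != v ->
    u \in pasch_line L A -> v \in pasch_line L A -> op_line s M ->
    f u \in M -> f v \in M ->
    M \in [set f @: (M : {set _}) | M in pasch_lines (lines C) set0].
  move=> LC AL uv uA vA hLM uM vM.
  have [A' [AL' oA' uA' vA']] : exists A' : {set _}, [/\ A' \subset L, odd #|A'| = false,
      u \in pasch_line L A' & v \in pasch_line L A'].
    have [oA|oA] := boolP (odd #|A|); last by exists A; rewrite (negbTE oA).
    have [A' [? oA' ? ?]] := pasch_line_switch (card_line LC) AL uv uA vA.
    by exists A'; rewrite oA' oA.
  have inS : pasch_line L A' \in pasch_lines (lines C) set0.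
    by apply/pasch_linesP; exists L, A'; rewrite inE.
  rewrite (@lineE (f u) (f v) M (f @: pasch_line L A')) ?imset_f ?hM //.
  by rewrite inj_eq.
apply: steiner_triple_systemI.
- move=> M /setUP[/setDP[]|/imsetP[_ /pasch_linesP[L [A [LC _ _ ->]]] ->]].
    by rewrite inE => /op_lineP[].
  by rewrite card_imset // card_pasch_line (card_line LC).
- move=> x y xy; have hL := op_line3 hs xy; set M := [set _; _; _] in hL.
  have xM : x \in M by apply/set3P/Or31.
  have yM : y \in M by apply/set3P/Or32.
  have [/imsetP[K /pasch_linesP[L [A [LC AL oA ->]]] ME]|MN] :=
    boolP (M \in [set f @: (M : {set _}) | M in pasch_lines (lines C) set0]);
    last by exists M; rewrite in_setU in_setD MN inE hL.
  (* The line of [s] through [x] and [y] is an even Pasch line; the pair is covered by the Pasch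
     line over the same [L] with the parity that [S] requires. *)
  move: (xM) (yM); rewrite ME => /imsetP[u uA xu] /imsetP[v vA yv].
  have uv : u != v by apply: contraNneq xy => E; rewrite xu yv E.
  have [A' [AL' oA' uA' vA']] : exists A' : {set _}, [/\ A' \subset L, odd #|A'| = (L \in S),
      u \in pasch_line L A' & v \in pasch_line L A'].
    have [LS|LS] := boolP (L \in S); last by exists A; rewrite oA inE.
    have [A' [? oA' ? ?]] := pasch_line_switch (card_line LC) AL uv uA vA.
    by exists A'; rewrite oA' oA inE.
  exists (f @: pasch_line L A'); rewrite xu yv !imset_f //; split=> //.
  apply/setUP; right; apply: imset_f; apply/pasch_linesP.
  by exists L, A'.
move=> L M x y.
case/setUP=> [/setDP[hL LN]|/imsetP[_ /pasch_linesP[L' [A [LC AL oA ->]]] ->]];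
  case/setUP=> [/setDP[hL' MN]|/imsetP[_ /pasch_linesP[M' [B [MC BM oB ->]]] ->]].
- by rewrite !inE in hL hL'; apply: lineE.
- rewrite inE in hL; move=> xy xL yL /imsetP[u uB xu] /imsetP[v vB yv].
  case/negP: LN; rewrite xu in xL xy; rewrite yv in yL xy.
  by apply: (cross M' B L u v) => //; apply: contraNneq xy => ->.
- rewrite inE in hL'; move=> xy /imsetP[u uB xu] /imsetP[v vB yv] xL yL.
  case/negP: MN; rewrite xu in xL xy; rewrite yv in yL xy.
  by apply: (cross L' A M u v) => //; apply: contraNneq xy => ->.
move=> xy /imsetP[u uA xu] /imsetP[v vA yv]; rewrite xu yv !mem_imset // => uB vB.
have uv : u != v by apply: contraNneq xy => E; rewrite xu yv E.
have [LM AB] := pasch_line_meet LC MC AL BM uv uA vA uB vB.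
by rewrite LM AB // oA oB LM.
Qed.

(** * Cancellation in signed sums, and isomorphic copies *)

(** Toggling [x] is an involution on the subsets of [N] that preserves [g] and reverses the sign, so
    the sum equals its own negative. *)
Lemma sum_toggle_eq0 (R : realFieldType) (T : finType) (x : T) (N : {set T})
    (g : {set T} -> R) :
  x \in N -> (forall S, g (toggle x S) = g S) ->
  \sum_(S in powerset N) (-1) ^+ #|S| * g S = 0.
Proof.
move=> xN hg; apply/eqP; rewrite -eqNr; apply/eqP.
rewrite -sumrN [RHS](reindex_inj (can_inj (toggleK x))) /=.
apply: eq_big => [S|S _].
  rewrite !powersetE; apply/idP/idP => /subsetP h; apply/subsetP => y.
    by rewrite in_toggle; case: eqVneq => [->//|_] /=; apply: h.
  move=> yS; have [->//|yx] := eqVneq y x.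
  by apply: h; rewrite in_toggle (negbTE yx).
by rewrite hg -signr_odd -[in RHS]signr_odd odd_toggle signrN mulNr.
Qed.

Lemma isomorphic_imset (P Q V : finType) (A : {set {set P}}) (B : {set {set Q}})
    (g : Q -> V) (q0 : Q) :
  injective g ->
  isomorphic A [set g @: (L : {set Q}) | L in B] = isomorphic A B.
Proof.
move=> gi.
have coverE : cover [set g @: (L : {set Q}) | L in B] = g @: cover B.
  apply/setP => v; apply/bigcupP/imsetP.
    move=> [_ /imsetP[L LB ->] /imsetP[q qL ->]]; exists q => //.
    by apply/bigcupP; exists L.
  move=> [q /bigcupP[L LB qL] ->]; exists (g @: L); exact: imset_f.
apply/existsP/existsP => -[f /and3P[/dinjectiveP fi /eqP fc /eqP fl]].
  (* [f] followed by a partial inverse of [g]; the default [q0] is never taken on the cover of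
     [A]. *)
  pose h := [ffun x => odflt q0 [pick q | g q == f x]].
  have gh : {in cover A, forall x, g (h x) = f x}.
    move=> x xA; rewrite ffunE; case: pickP => [q /eqP//|no].
    have : f x \in g @: cover B by rewrite -coverE -fc imset_f.
    by case/imsetP=> q _ fq; move: (no q); rewrite fq eqxx.
  have gimset (D : {set P}) : D \subset cover A -> g @: (h @: D) = f @: D.
    move=> /subsetP DA; rewrite -imset_comp; apply: eq_in_imset => x xD.
    by apply: gh; apply: DA.
  exists h; apply/and3P; split.
  - by apply/dinjectiveP => x y xA yA E; apply: fi; rewrite // -!gh // E.
  - by apply/eqP; apply: (imset_inj gi); rewrite gimset // fc coverE.
  - apply/eqP; apply: (imset_inj (imset_inj gi)); rewrite -fl -imset_comp.
    by apply: eq_in_imset => L LA /=; rewrite gimset //; apply: bigcup_sup.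
exists [ffun x => g (f x)].
have himset (D : {set P}) : [ffun x => g (f x)] @: D = g @: (f @: D).
  by rewrite -imset_comp; apply: eq_imset => x; rewrite ffunE.
apply/and3P; split.
- by apply/dinjectiveP => x y xA yA; rewrite !ffunE => /gi; apply: fi.
- by rewrite himset fc coverE.
- apply/eqP; rewrite -fl -imset_comp; apply: eq_imset => L /=; exact: himset.
Qed.

Lemma isomorphic_refl (P : finType) (A : {set {set P}}) : isomorphic A A.
Proof.
apply/existsP; exists [ffun x => x].
have idE (D : {set P}) : [ffun x => x] @: D = D.
  by rewrite -[RHS]imset_id; apply: eq_imset => x; rewrite ffunE.
apply/and3P; split; first by apply/dinjectiveP => x y _ _; rewrite !ffunE.
  by rewrite idE.
by apply/eqP; rewrite -[RHS]imset_id; apply: eq_imset.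
Qed.

Lemma isomorphic_card_le (P Q : finType) (A : {set {set P}}) (B : {set {set Q}}) :
  isomorphic A B -> (#|B| <= #|A|)%N.
Proof.
by case/existsP=> f /and3P[_ _ /eqP <-]; apply: leq_imset_card.
Qed.

(** A second line of [D] through the preimage of [q] is mapped to a second line through [q],
    distinct from [M] because [f] is injective on the cover. *)
Lemma isomorphic_full (D : configuration) (Q : finType) (B : {set {set Q}}) M q :
  full D -> isomorphic (lines D) B -> M \in B -> q \in M ->
  exists M', [/\ M' \in B, q \in M' & M' != M].
Proof.
move=> fD /existsP[f /and3P[/dinjectiveP fi _ /eqP <-]] /imsetP[L LD ->].
case/imsetP=> x xL ->.
have xc : x \in cover (lines D) by apply/bigcupP; exists L.
have [L' [L'D xL' nL']] : exists L', [/\ L' \in lines D, x \in L' & L' != L].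
  have /card_gt1P[L1 [L2 []]] := fD x xc; rewrite !inE.
  move=> /andP[L1D x1] /andP[L2D x2] n12.
  have [E|n1] := eqVneq L1 L; last by exists L1.
  by exists L2; rewrite -E eq_sym.
exists (f @: L'); rewrite !imset_f //; split=> //.
apply: contraNneq nL' => E; apply/eqP/setP => y.
have sub K : K \in lines D -> K \subset cover (lines D) by move=> KD; apply: bigcup_sup.
have inK K y' : K \in lines D -> y' \in cover (lines D) -> (f y' \in f @: K) = (y' \in K).
  move=> KD yc; apply/imsetP/idP => [[z zK E']|yK]; last by exists y'.
  by rewrite (fi y' z) //; apply: (subsetP (sub K KD)).
have [yc|yc] := boolP (y \in cover (lines D)).
  by rewrite -(inK L') // -(inK L) // E.
by rewrite !(contraNF (subsetP (sub _ _) y) yc).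
Qed.

(** * Alternating sums over the switches *)

Lemma op_switch_toggle (P V : finType) (s : V -> V -> V) f
    (N S : {set {set P}}) (L : {set P}) (M : {set V}) :
  (forall A : {set P}, A \subset L -> M != f @: pasch_line L A) ->
  (M \in op_switch s f N (toggle L S)) = (M \in op_switch s f N S).
Proof.
move=> hM; rewrite !in_setU; congr (_ || _).
have half S' : M \in [set f @: (K : {set _}) | K in pasch_lines N S'] ->
    M \in [set f @: (K : {set _}) | K in pasch_lines N (toggle L S')].
  case/imsetP=> _ /pasch_linesP[K [A [KN AK oA ->]]] ME.
  rewrite ME; apply: imset_f; apply/pasch_linesP; exists K, A; split=> //.
  rewrite in_toggle; case: eqVneq => //= KL.
  by subst K; move: (hM A AK); rewrite ME eqxx.
by apply/idP/idP => /half //; rewrite toggleK.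
Qed.

Lemma full_transversal (C D : configuration) (V : finType) f (B : {set {set V}}) :
  injective f -> full D -> (#|lines D| <= #|lines C|)%N ->
  isomorphic (lines D) B ->
  (forall L, L \in lines C -> exists2 A : {set _}, A \subset L & f @: pasch_line L A \in B) ->
  B = [set f @: pasch_line L set0 | L in lines C].
Proof.
move=> fi fD cDC iDB hB.
have [h hh] : exists h : {set conf_type C} -> {set conf_type C}, forall L,
    L \in lines C -> h L \subset L /\ f @: pasch_line L (h L) \in B.
  apply: (@fin_all_exists _ (fun=> _) (fun L (A : {set conf_type C}) =>
    L \in lines C -> A \subset L /\ f @: pasch_line L A \in B)) => L.
  have [/hB[A AL AB]|_] := boolP (L \in lines C); first by exists A.
  by exists set0.
(* The chosen lines are distinct and number [#|lines C|], while [B] has at most [#|lines D|] lines;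
   so they exhaust [B]. *)
have BE : B = [set f @: pasch_line L (h L) | L in lines C].
  apply/esym/eqP; rewrite eqEcard; apply/andP; split.
    by apply/subsetP => _ /imsetP[L /hh[_ LB] ->].
  rewrite card_in_imset.
    exact: leq_trans (isomorphic_card_le iDB) cDC.
  move=> L M LC MC /(imset_inj fi) E.
  by have [] := pasch_line_inj (proj1 (hh L LC)) (proj1 (hh M MC)) E.
(* A new point over [L] lies on no line over another member of [lines C], hence on only one line of
   [B], against fullness. *)
have h0 L : L \in lines C -> h L = set0.
  move=> LC; apply/eqP/set0Pn => -[p ph]; have [hL LB] := hh L LC.
  have pL := subsetP hL p ph.
  have qM : f (inr (L, p)) \in f @: pasch_line L (h L).
    by apply: imset_f; rewrite inr_pasch_line pL ph eqxx.
  have [M' [M'B qM' /negP]] := isomorphic_full fD iDB LB qM; apply.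
  move: M'B qM'; rewrite BE => /imsetP[K KC ->].
  by rewrite mem_imset // inr_pasch_line => /and3P[_ _ /eqP->].
by rewrite BE; apply: eq_in_imset => L LC; rewrite h0.
Qed.

(** If [B] has no line over some [L], switching at [L] does not affect whether the system contains
    [B], and the terms cancel. Otherwise [B] is the original copy of [C], which is present only for
    [S = set0]. *)
Lemma signed_switch_sum (R : realFieldType) (C D : configuration) (V : finType)
    (s : V -> V -> V) f (B : {set {set V}}) :
  injective f ->
  (forall M, M \in pasch_lines (lines C) set0 -> op_line s (f @: M)) ->
  full D -> (#|lines D| <= #|lines C|)%N -> isomorphic (lines D) B ->
  \sum_(S in powerset (lines C))
     (-1) ^+ #|S| * (B \subset op_switch s f (lines C) S)%:R
  = (B == [set f @: pasch_line L set0 | L in lines C])%:R :> R.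
Proof.
move=> fi hM fD cDC iDB; set B0 := [set _ | _ in _].
have [/exists_inP[L LC /forallP avoid]|] := boolP [exists L in lines C,
    [forall A : {set _}, (A \subset L) ==> (f @: pasch_line L A \notin B)]].
  rewrite (sum_toggle_eq0 LC) => [|S].
    case: eqP => // E; have := avoid set0; rewrite sub0set E /=.
    by rewrite imset_f.
  have av M (A : {set _}) : M \in B -> A \subset L -> M != f @: pasch_line L A.
    move=> MB AL; have /implyP/(_ AL) := avoid A.
    by apply: contraNneq => <-.
  congr (nat_of_bool _)%:R; apply/subsetP/subsetP => h M MB.
    by rewrite -(@op_switch_toggle _ _ s f _ _ L) ?h // => A; apply: av.
  by rewrite op_switch_toggle ?h // => A; apply: av.
rewrite negb_exists_in => /forall_inP hB.
have BE : B = B0.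
  apply: full_transversal iDB _ => // L LC; have := hB L LC.
  rewrite negb_forall => /existsP[A]; rewrite negb_imply negbK => /andP[AL AB].
  by exists A.
rewrite BE eqxx (bigD1 set0) ?powersetE ?sub0set //= cards0 expr0 mul1r.
have -> : B0 \subset op_switch s f (lines C) set0.
  apply/subsetP => _ /imsetP[L LC ->]; apply/setUP; right; apply: imset_f.
  by apply/pasch_linesP; exists L, set0; rewrite sub0set cards0 inE.
rewrite big1 ?addr0 // => S /andP[]; rewrite powersetE => /subsetP SC.
(* Over a switched [L] only odd sets are allowed, so the original line, given by the empty set, is
   missing. *)
case/set0Pn=> L LS; have LC := SC L LS.
rewrite (_ : _ \subset _ = false) ?mulr0 //; apply/negP => /subsetP.
move/(_ (f @: pasch_line L set0) (imset_f _ LC)).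
have L0 : pasch_line L set0 \in pasch_lines (lines C) set0.
  by apply/pasch_linesP; exists L, set0; rewrite sub0set cards0 inE.
case/setUP=> [/setDP[_]|]; first by rewrite imset_f.
case/imsetP=> _ /pasch_linesP[M [A [MC AM oA ->]]] /(imset_inj fi) E.
have [LM A0] := pasch_line_inj (sub0set _) AM E.
by move: oA; rewrite -A0 cards0 -LM LS.
Qed.

(** Occurrences are summed over candidate sets [B] and the two sums exchanged; only [B0], the copy
    of [C] on the old points, can have a nonzero signed sum. *)
Lemma signed_occurrences (R : realFieldType) (C D : configuration) (V : finType)
    (s : V -> V -> V) f :
  injective f ->
  (forall M, M \in pasch_lines (lines C) set0 -> op_line s (f @: M)) ->
  full D -> (#|lines D| <= #|lines C|)%N ->
  \sum_(S in powerset (lines C))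
     (-1) ^+ #|S| * (occurrences D (op_switch s f (lines C) S))%:R
  = (isomorphic (lines D) (lines C))%:R :> R.
Proof.
move=> fi hM fD cDC; set B0 := [set f @: pasch_line L set0 | L in lines C].
transitivity (\sum_(B : {set {set V}} | isomorphic (lines D) B) (B == B0)%:R : R).
  under [RHS]eq_bigr => B iDB do
    rewrite -(@signed_switch_sum R C D V s f B fi hM fD cDC iDB).
  rewrite exchange_big /=; apply: eq_bigr => S _.
  rewrite -mulr_sumr -natr_sum; congr (_ * _%:R).
  rewrite /occurrences -sum1_card big_mkcond [RHS]big_mkcond /=.
  by apply: eq_bigr => B _; rewrite inE andbC; case: isomorphic; case: (_ \subset _).
rewrite -natr_sum; congr (_%:R).
(* Some point of [C] is needed as the default value in [isomorphic_imset]. *)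
have [L LC] := set0Pn _ (lines_neq0 C).
have /card_gt0P[q0 _] : (0 < #|L|)%N by rewrite (card_line LC).
have B0E : B0 = [set (f \o inl) @: (L : {set _}) | L in lines C].
  apply: eq_imset => K; rewrite imset_comp.
  have -> // : pasch_line K set0 = inl @: K.
  by apply: eq_imset => p; rewrite /pasch_point inE.
have -> : isomorphic (lines D) (lines C) = isomorphic (lines D) B0.
  by rewrite B0E (isomorphic_imset _ _ q0) // => x y /fi[].
rewrite big_mkcond (bigD1 B0) //= eqxx big1 ?addn0 => [|B /negbTE->].
  by case: isomorphic.
by case: isomorphic.
Qed.

(** * Contradiction from a supposed linear relation *)

Theorem theorem7 (R : realFieldType) (n : nat) (hn : (n <= 8)%N) :
  ~ exists C : configuration,
      [/\ n_line n C,
          full C &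
          exists (k : nat) (D : 'I_k -> configuration)
                 (c : nat -> R) (a : 'I_k -> nat -> R),
            (forall i : 'I_k,
                [/\ full (D i),
                    exists2 m : nat, (m <= n)%N & n_line m (D i) &
                    ~~ isomorphic (lines (D i)) (lines C)]) /\
            (forall (v : nat) (V : finType) (B : {set {set V}}),
                #|V| = v -> steiner_triple_system B ->
                (occurrences C B)%:R =
                  c v + \sum_(i < k) a i v * (occurrences (D i) B)%:R)].
Proof.
move=> [C [nC fC [k [D [c [a [hD hocc]]]]]]].
have [V [s [f [hs fi hM]]]] := pasch_lines_embedding C.
have [L LC] := set0Pn _ (lines_neq0 C).
have := signed_occurrences R fi hM fC (leqnn _).
rewrite isomorphic_refl.
(* All switched systems live on the same [V], so the coefficients do not vary in the alternating
   sum. *)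
under eq_bigr => S _ do
  rewrite (hocc #|V| V _ erefl (op_switch_sts S hs fi hM)) mulrDr mulr_sumr.
(* The constant term cancels by toggling the line [L] of [C]. *)
rewrite big_split /= (@sum_toggle_eq0 _ _ L _ (fun=> _) LC) // add0r exchange_big.
(* Each remaining term vanishes, as [D i] is not isomorphic to [C]; this contradicts the value 1
   obtained for [C] itself. *)
rewrite big1 => [/eqP|i _]; first by rewrite eq_sym oner_eq0.
have [fDi [m mn mD] nDi] := hD i.
under eq_bigr => S _ do rewrite mulrCA.
rewrite -mulr_sumr (signed_occurrences R fi hM fDi) ?(negbTE nDi) ?mulr0 //.
by rewrite mD nC.
Qed.
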